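(* Let $n$ be an odd positive integer and let $m=2^l m_1$, where $m_1$ is an odd positive integer and $l\ge 0$ is an integer. Then $L_m(n)=l$.
   Context: For positive integers $m,n$, the Ducci function is the map $D:\mathbb{Z}_m^n\to\mathbb{Z}_m^n$ (where $\mathbb{Z}_m=\mathbb{Z}/m\mathbb{Z}$) given by $D(x_1,x_2,\dots,x_n)=(x_1+x_2,\,x_2+x_3,\,\dots,\,x_n+x_1)$, all entries taken modulo $m$ (indices are cyclic modulo $n$; for $n=1$, $D(x_1)=(2x_1)$). $D^{\alpha}$ denotes the $\alpha$-fold iterate, $D^0$ being the identity. For $\mathbf{u}\in\mathbb{Z}_m^n$, the length $\mathrm{Len}(\mathbf{u})$ is the smallest integer $\alpha\ge 0$ for which there exists an integer $\beta\ge 1$ with $D^{\alpha+\beta}(\mathbf{u})=D^{\alpha}(\mathbf{u})$. Define $L_m(n)=\mathrm{Len}(0,0,\dots,0,1)$, where $(0,0,\dots,0,1)\in\mathbb{Z}_m^n$. *)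

(* Defs.v *)
From mathcomp Require Import all_boot all_order all_algebra.
From mathcomp Require Import boolp.

Set Implicit Arguments.
Unset Strict Implicit.
Unset Printing Implicit Defensive.

Import GRing.Theory.
Local Open Scope ring_scope.

(* Z/mZ for every m > 0, including the trivial group for m = 1; this is why
   'Z_m, which is Z/2Z at m = 1, is not used. Addition is the canonical one of
   'I_p.+1, i.e. addition modulo m; the class of k is inZp k. *)
Notation Zmod m := 'I_m.-1.+1.

Definition ducci (m n : nat) (u : 'rV[Zmod m]_n) : 'rV[Zmod m]_n :=
  \row_(i < n) (u 0 i + u 0 (ordS i)).

Definition eventually_periodic_at (m n : nat) (u : 'rV[Zmod m]_n) (a : nat) :
  Prop :=
  exists b : nat,
    (1 <= b)%N /\ iter (a + b) (@ducci m n) u = iter a (@ducci m n) u.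

Lemma ducci_len_exists (m n : nat) (u : 'rV[Zmod m]_n) :
  exists a : nat, `[< eventually_periodic_at u a >].
Proof.
pose f (i : 'I_#|{: 'rV[Zmod m]_n}|.+1) := iter i (@ducci m n) u.
have /injectivePn [x [y nxy fxy]] : ~~ injectiveb f.
  apply/injectiveP => /leq_card; by rewrite card_ord ltnn.
wlog lt_xy : x y nxy fxy / (x < y)%N.
  move=> H; have [lt|lt|/val_inj e] := ltngtP x y; first exact: (H x y).
    by apply: (H y x); rewrite // eq_sym.
  by rewrite e eqxx in nxy.
exists x; apply/asboolP; exists (y - x)%N; split; first by rewrite subn_gt0.
by rewrite subnKC ?(ltnW lt_xy).
Qed.

Definition Len (m n : nat) (u : 'rV[Zmod m]_n) : nat :=
  ex_minn (ducci_len_exists u).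

(* The tuple (0, ..., 0, 1). *)
Definition last_unit (m n : nat) : 'rV[Zmod m]_n :=
  \row_(i < n) (if i.+1 == n then inZp 1 else 0).

Definition L (m n : nat) : nat := Len (last_unit m n).

(* Main.v *)
Require Import Defs.
From mathcomp Require Import all_boot all_order all_algebra.
From mathcomp Require Import boolp.

(** The Ducci map D is additive and doubles the sum of the entries. The entry sum
    of (0, ..., 0, 1) is 1, so D^(a+b) u = D^a u forces 2^l | 2^a (2^b - 1), whence
    l <= a. Conversely, ker D^(l+1) = ker D^l: if w = D^l v and D w = 0, then
    entries of w alternate in sign around a cycle of odd length, so w is constant
    with 2 w = 0, and each entry of w equals the entry sum 2^l s of w; finally
    m | 2^(l+1) s implies m | 2^l s. Hence the equation D^a (D^b u - u) = 0, which
    holds for some a and b, descends to a = l. *)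

Set Implicit Arguments.
Unset Strict Implicit.
Unset Printing Implicit Defensive.

Import GRing.Theory.
Local Open Scope ring_scope.

Lemma val_iter_ordS n k (i : 'I_n) : iter k (@ordS n) i = ((i + k) %% n)%N :> nat.
Proof.
elim: k => [|k IHk]; first by rewrite addn0 modn_small.
by rewrite iterS /= IHk -addn1 modnDml addn1 addnS.
Qed.

Lemma iter_ordS_id n (i : 'I_n) : iter n (@ordS n) i = i.
Proof. by apply: val_inj; rewrite /= val_iter_ordS modnDr modn_small. Qed.

Lemma iter_ordS_trans n (i j : 'I_n) : exists k, j = iter k (@ordS n) i.
Proof.
(* From [i], the first [n - i] steps wrap around to index 0 and [j] more reach [j]. *)
exists (n - i + j)%N; apply: val_inj.
by rewrite /= val_iter_ordS addnA subnKC ?(ltnW (ltn_ord i)) // modnDl modn_small.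
Qed.

Section Alternating.
Variables (V : zmodType) (n : nat) (f : 'I_n -> V).
Hypotheses (odd_n : odd n) (f_alt : forall i, f i + f (ordS i) = 0).

(** One trip around the cycle makes [n] sign changes, an odd number, so [f i = - f i]. *)
Lemma alternating_odd_double i : f i *+ 2 = 0.
Proof.
have fN k : f (iter k (@ordS n) i) = if odd k then - f i else f i.
  elim: k => //= k IHk; move/eqP: (f_alt (iter k (@ordS n) i)).
  by rewrite addrC addr_eq0 IHk => /eqP->; case: (odd k); rewrite ?opprK.
by have := fN n; rewrite iter_ordS_id odd_n mulr2n => {1}->; rewrite addNr.
Qed.

Lemma alternating_odd_const i j : f i = f j.
Proof.
have [k ->] := iter_ordS_trans j i; elim: k => //= k <-.
set x := iter k _ j; apply: (addrI (f x)).
by rewrite f_alt -mulr2n alternating_odd_double.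
Qed.

(** The [n] terms are equal and killed by 2, so they cancel in pairs and, [n] being odd, one is
    left. *)
Lemma alternating_odd_sum i : \sum_j f j = f i.
Proof.
rewrite (eq_bigr (fun=> f i)) => [|j _]; last exact: alternating_odd_const.
rewrite sumr_const card_ord -(odd_double_half n) odd_n -muln2 mulnC.
by rewrite mulrnDr mulrnA alternating_odd_double mul0rn addr0.
Qed.

End Alternating.

Section Ducci.
Variables m n : nat.
Implicit Types u v : 'rV[Zmod m]_n.

Lemma iter_ducciB k u v :
  iter k (@ducci m n) (u - v) = iter k (@ducci m n) u - iter k (@ducci m n) v.
Proof.
elim: k => //= k ->; apply/rowP => i; rewrite !mxE.
by rewrite addrACA -opprD.
Qed.

Lemma iter_ducci0 k : iter k (@ducci m n) 0 = 0.
Proof. by rewrite -[X in iter _ _ X](subrr 0) iter_ducciB subrr. Qed.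

Lemma sum_iter_ducci k u :
  \sum_i iter k (@ducci m n) u 0 i = (\sum_i u 0 i) *+ 2 ^ k.
Proof.
elim: k => [|k IHk]; first by rewrite mulr1n.
rewrite expnS mulnC mulrnA -IHk mulr2n iterS.
under eq_bigr do rewrite mxE.
rewrite big_split /=; congr (_ + _).
(* The cyclic shift permutes the indices, so both halves of the split sum agree. *)
by rewrite [RHS](reindex_inj (@ordS_inj n)).
Qed.

Lemma sum_last_unit : (0 < n)%N -> \sum_i last_unit m n 0 i = inZp 1.
Proof.
case: n => // k _; rewrite (bigD1 ord_max) //= mxE eqxx big1 ?addr0 // => i.
by rewrite -val_eqE mxE eqSS /= => /negbTE->.
Qed.

End Ducci.

Lemma Zmod_mulrn_eq0 m (s : Zmod m) k :
  (0 < m)%N -> (s *+ k == 0) = (m %| s * k)%N.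
Proof. by case: m s => // p s _; rewrite Zp_mulrn. Qed.

Section OddLength.
Variables n l m1 : nat.
Hypotheses (odd_n : odd n) (odd_m1 : odd m1).
Local Notation m := (2 ^ l * m1)%N.

Let m_gt0 : (0 < m)%N.
Proof. by rewrite muln_gt0 expn_gt0 (odd_gt0 odd_m1). Qed.

Lemma iter_ducci_kernel_stable (v : 'rV[Zmod m]_n) :
  iter l.+1 (@ducci m n) v = 0 -> iter l (@ducci m n) v = 0.
Proof.
rewrite iterS; set w := iter l _ v => Dw0.
have w_alt i : w 0 i + w 0 (ordS i) = 0 by move/rowP: Dw0 => /(_ i); rewrite !mxE.
apply/rowP => i; rewrite [RHS]mxE.
have := alternating_odd_double odd_n w_alt i.
rewrite -(alternating_odd_sum odd_n w_alt i) sum_iter_ducci.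
rewrite -mulrnA => /eqP; rewrite Zmod_mulrn_eq0 // => m_dvd.
apply/eqP; rewrite Zmod_mulrn_eq0 //; move: (nat_of_ord _) m_dvd => s.
(* Cancelling [2 ^ l] leaves [m1 %| s * 2], and the odd [m1] must divide [s]. *)
rewrite mulnA !(mulnC s) -mulnA !dvdn_pmul2l ?expn_gt0 //.
by rewrite Gauss_dvdl // coprimen2.
Qed.

Lemma eventually_periodic_at_exponent (u : 'rV[Zmod m]_n) :
  eventually_periodic_at u l.
Proof.
have [a /asboolP [b [b_gt0 Dab]]] := ducci_len_exists u.
exists b; split=> //; rewrite iterD; apply/eqP; rewrite -subr_eq0 -iter_ducciB.
set v := (X in iter l _ X); apply/eqP.
have : iter (l + a) (@ducci m n) v = 0.
  by rewrite iterD [iter a _ v]iter_ducciB -iterD Dab subrr iter_ducci0.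
(* Here [v] is [D^b u - u]; kernel stability applied to [D^a v] removes one iteration at a time,
   down to [l]. *)
elim: a {Dab} => [|a IHa]; rewrite ?addn0 // => Dv0; apply: IHa.
by rewrite iterD; apply: iter_ducci_kernel_stable; rewrite -iterD addSnnS.
Qed.

Lemma eventually_periodic_at_lower_bound a :
  eventually_periodic_at (last_unit m n) a -> (l <= a)%N.
Proof.
case=> b [b_gt0 Dab].
have := congr1 (fun w : 'rV[Zmod m]_n => \sum_i w 0 i) Dab.
rewrite !sum_iter_ducci sum_last_unit ?odd_gt0 // => /(congr1 val).
(* The value of [inZp 1] is [1 %% m], which is 0 when [m = 1]; [modnMml] absorbs this residue, so
   that case needs no separate argument. *)
rewrite !Zp_mulrn /= !modnMml !mul1n prednK // => /eqP.
rewrite eqn_mod_dvd ?leq_pexp2l ?leq_addr // => /(dvdn_trans (dvdn_mulr m1 (dvdnn _))).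
rewrite expnD -{2}[(2 ^ a)%N]muln1 -mulnBr Gauss_dvdl ?dvdn_Pexp2l //.
(* The cofactor [2 ^ b - 1] is odd because [b > 0]. *)
rewrite coprimeXl // coprime2n oddB ?expn_gt0 // oddX.
by move: b_gt0; case: b {Dab}.
Qed.

End OddLength.

Theorem theorem2 (n m l m1 : nat) (hn : odd n) (hm1 : odd m1)
  (hm : m = (2 ^ l * m1)%N) : L m n = l.
Proof.
subst m; rewrite /L /Len; case: ex_minnP => a /asboolP a_per a_min.
apply/eqP; rewrite eqn_leq (eventually_periodic_at_lower_bound hn hm1 a_per) andbT.
by apply: a_min; apply/asboolP; apply: eventually_periodic_at_exponent.
Qed.
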